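(* Let $\mathcal{H}$ be a Hilbert $C^*$-module over a unital $C^*$-algebra $\mathcal{A}$, let $\{\mathcal{H}_j\}_{j\in J}$ be a family of closed submodules of $\mathcal{H}$, and let $C,C'\in GL^+(\mathcal{H})$. Let $\{\Lambda_j:j\in J\}$ with $\Lambda_j\in End_{\mathcal{A}}^*(\mathcal{H},\mathcal{H}_j)$ be such that $C$ and $C'$ commute with each other and with $\Lambda_j^*\Lambda_j$ for each $j\in J$, and such that $\sum_{j\in J}\langle\Lambda_jCf,\Lambda_jC'f\rangle$ converges in norm for every $f\in\mathcal{H}$. Then $\{\Lambda_j:j\in J\}$ is a $(C,C')$-controlled g-frame for $\mathcal{H}$ with respect to $\{\mathcal{H}_j\}_{j\in J}$ if and only if there exist constants $A,B>0$ such that $$A\|f\|^2\le\Big\|\sum_{j\in J}\langle\Lambda_jCf,\Lambda_jC'f\rangle\Big\|\le B\|f\|^2\quad\text{for all } f\in\mathcal{H}.$$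
   Context: $\mathcal{A}$ is a unital $C^*$-algebra, and $\mathcal{H}$ is a (left) Hilbert $\mathcal{A}$-module with $\mathcal{A}$-valued inner product $\langle\cdot,\cdot\rangle$ ($\mathcal{A}$-linear in the first variable) and norm $\|f\|=\|\langle f,f\rangle\|^{1/2}$. $J$ is any index set. $End_{\mathcal{A}}^*(\mathcal{H},\mathcal{H}_j)$ is the set of adjointable $\mathcal{A}$-linear operators $\mathcal{H}\to\mathcal{H}_j$. $GL^+(\mathcal{H})$ is the set of all positive bounded linear invertible operators on $\mathcal{H}$ with bounded inverse. For $C,C'\in GL^+(\mathcal{H})$, a family $\{\Lambda_j\in End_{\mathcal{A}}^*(\mathcal{H},\mathcal{H}_j):j\in J\}$ is a $(C,C')$-controlled g-frame for $\mathcal{H}$ with respect to $\{\mathcal{H}_j\}_{j\in J}$ if there exist constants $0<A\le B<\infty$ such that $A\langle f,f\rangle\le\sum_{j\in J}\langle\Lambda_jCf,\Lambda_jC'f\rangle\le B\langle f,f\rangle$ for all $f\in\mathcal{H}$. *)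

(* Defs.v *)
From HB Require Import structures.
From mathcomp Require Import all_boot all_order all_algebra.
From mathcomp Require Import complex.
From mathcomp Require Import boolp classical_sets reals topology normedtype.
From mathcomp Require Import summability.
Set Implicit Arguments.
Unset Strict Implicit.
Unset Printing Implicit Defensive.
Import Order.TTheory GRing.Theory Num.Theory.
Import numFieldNormedType.Exports.

Local Open Scope classical_set_scope.
Local Open Scope ring_scope.
Local Open Scope complex_scope.

(* [numDomainType] is the library's only join of rings and normed modules, and
   the hierarchy accepts no weaker one afterwards. So the product and the unit
   are fields here, and the ring structure is an instance built from them. The
   zero algebra is allowed. *)
HB.mixin Record isCStarAlgebra (R : realType) A
    of CompleteNormedModule R[i] A := {
  cmul : A -> A -> A;
  cone : A;
  cmulA : associative cmul;
  cmul1l : left_id cone cmul;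
  cmul1r : right_id cone cmul;
  cmulDl : left_distributive cmul +%R;
  cmulDr : right_distributive cmul +%R;
  cscaleAl : forall (z : R[i]) a b, z *: cmul a b = cmul (z *: a) b;
  cscaleAr : forall (z : R[i]) a b, z *: cmul a b = cmul a (z *: b);
  star : A -> A;
  starD : forall a b, star (a + b) = star a + star b;
  starZ : forall (z : R[i]) a, star (z *: a) = z^* *: star a;
  starM : forall a b, star (cmul a b) = cmul (star b) (star a);
  starK : involutive star;
  normM_le : forall a b, `|cmul a b| <= `|a| * `|b|;
  norm_starM : forall a, `|cmul (star a) a| = `|a| ^+ 2
}.

#[short(type="cstarAlgType")]
HB.structure Definition CStarAlgebra (R : realType) :=
  {A of CompleteNormedModule R[i] A & isCStarAlgebra R A}.

#[non_forgetful_inheritance]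
HB.instance Definition _ (R : realType) (A : cstarAlgType R) :=
  GRing.Zmodule_isPzRing.Build A
    cmulA cmul1l cmul1r cmulDl cmulDr.

Definition invertible (R : realType) (A : cstarAlgType R) (a : A) : Prop :=
  exists b : A, a * b = 1 /\ b * a = 1.

Definition spectrum (R : realType) (A : cstarAlgType R) (a : A) : set R[i] :=
  [set z | ~ invertible (z *: (1 : A) - a)].

(* The order of [R[i]] is partial: [0 <= z] says that [z] is real and
   nonnegative. *)
Definition cstar_pos (R : realType) (A : cstarAlgType R) (a : A) : Prop :=
  star a = a /\ spectrum a `<=` [set z | 0 <= z].

Definition cstar_le (R : realType) (A : cstarAlgType R) (a b : A) : Prop :=
  cstar_pos (b - a).

(* The library's [lmodType] cannot put the scalings by [A] and by [R[i]] on the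
   same carrier, so the former is the operation [amul]; [amul_scalar] makes the
   two compatible. Since [`|_|] is a norm, [norm_inner] contains the
   definiteness of the inner product. *)
HB.mixin Record isHilbertModule (R : realType) (A : cstarAlgType R) H
    of CompleteNormedModule R[i] H := {
  amul : A -> H -> H;
  amul1 : forall f, amul 1 f = f;
  amulA : forall a b f, amul a (amul b f) = amul (a * b) f;
  amulDl : forall a b f, amul (a + b) f = amul a f + amul b f;
  amulDr : forall a f g, amul a (f + g) = amul a f + amul a g;
  amul_scalar : forall (z : R[i]) f, amul (z *: (1 : A)) f = z *: f;
  inner : H -> H -> A;
  innerDl : forall f g h, inner (f + g) h = inner f h + inner g h;
  inner_amul : forall a f g, inner (amul a f) g = a * inner f g;
  inner_star : forall f g, inner g f = star (inner f g);
  inner_pos : forall f, cstar_pos (inner f f);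
  norm_inner : forall f : H, `|f| = sqrtC `|inner f f|
}.

#[short(type="hilbertModType")]
HB.structure Definition HilbertModule (R : realType) (A : cstarAlgType R) :=
  {H of CompleteNormedModule R[i] H & isHilbertModule R A H}.

Section Operators.
Context {R : realType} {A : cstarAlgType R} {H : hilbertModType A}.

Definition closed_submodule (V : set H) : Prop :=
  [/\ closed V, V 0, (forall f g, V f -> V g -> V (f + g))
    & (forall (a : A) f, V f -> V (amul a f))].

(* [End*_A(H, V)] for a submodule [V] of [H]. The adjoint is a field of the
   record; it is determined by the operator, by definiteness of the inner
   product. *)
Record adjointable (V : set H) := Adjointable {
  adj_op :> H -> V;
  adj_star : V -> H;
  adj_op_linear : forall (a : A) (f g : H),
    \val (adj_op (amul a f + g)) = amul a (\val (adj_op f)) + \val (adj_op g);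
  adj_opP : forall (f : H) (v : V),
    inner (\val (adj_op f)) (\val v) = inner f (adj_star v)
}.

Definition bounded_op (T : H -> H) : Prop :=
  exists M : R, forall f : H, `|T f| <= M%:C * `|f|.

Definition pos_op (T : H -> H) : Prop := forall f, cstar_pos (inner (T f) f).

(* Only linearity over [R[i]] is asked of [T]: a positive [T] is symmetric, hence
   adjointable and [A]-linear. *)
Definition GLplus (T : {linear H -> H}) : Prop :=
  [/\ bounded_op T, pos_op T
    & exists S : H -> H, [/\ cancel T S, cancel S T & bounded_op S]].

Section Controlled.
Context {J : choiceType} {V : J -> set H}.
Variables (C C' : H -> H) (L : forall j, adjointable (V j)).

Definition ctrl_term (f : H) (j : J) : A :=
  inner (\val (L j (C f))) (\val (L j (C' f))).

(* Norm convergence of the net of finite partial sums. *)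
Definition ctrl_cvg (f : H) : Prop :=
  cvg (partial_sum (ctrl_term f) @ totally).

(* Meaningful only under [ctrl_cvg f]: [lim] is total. *)
Definition ctrl_sum (f : H) : A := sum (ctrl_term f).

Definition controlled_gframe : Prop :=
  exists a b : R, 0 < a <= b /\
    forall f : H, [/\ ctrl_cvg f,
      cstar_le (a%:C *: inner f f) (ctrl_sum f)
    & cstar_le (ctrl_sum f) (b%:C *: inner f f)].

End Controlled.
End Operators.

(* Main.v *)
Require Import Defs.
From HB Require Import structures.
From mathcomp Require Import all_boot all_order all_algebra.
From mathcomp Require Import complex.
From mathcomp Require Import boolp classical_sets reals topology normedtype.
From mathcomp Require Import summability.
From mathcomp Require Import finmap sequences ring lra.
Set Implicit Arguments.
Unset Strict Implicit.
Unset Printing Implicit Defensive.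
Import Order.TTheory GRing.Theory Num.Theory.
Import numFieldNormedType.Exports.

Local Open Scope classical_set_scope.
Local Open Scope ring_scope.
Local Open Scope complex_scope.

(** With [P_j = L_j^* L_j] and [D = C C'], the terms of the series are
    [<P_j D f, f>], which are positive because commuting positive operators have
    a positive product. A norm bound on the sum therefore bounds all partial sums
    [S_F = \sum_(j in F) P_j D], which gives the upper estimate and the strong
    convergence of [S_F] to a positive operator [S] with [<S f, f>] equal to the
    sum of the series.

    For the lower estimate, take [X = 1 - S / M] with [0 <= X <= 1]. By telescoping,
    [n (1 - X) X^(2n) <= 1], so the lower norm bound forces [|X^n| <= 1/2] for
    some [n]; then [1/2 <= 1 - X^n <= n (1 - X)].

    Square roots of operators are avoided by expanding
    [0 <= <P (1 - X) f, (1 - X) f>], which gives [2 P X <= P + P X^2] and, after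
    iteration, [P X <= P] for every contraction [X] commuting with [P]. In the
    algebra itself, what is needed is that for [x] self-adjoint [|x|] or [-|x|]
    is in the spectrum; this comes from a norm estimate for [y / (1 - y)] along
    [y = x^2, x^4, x^8, ...]. *)

(** * The norm as an element of the ordered field [R] *)

Definition nr (R : realType) (E : normedModType R[i]) (x : E) : R := complex.Re `|x|.

Section RealNorm.
Context {R : realType} {E : normedModType R[i]}.
Implicit Types x y : E.

Lemma nrE x : `|x| = (nr x)%:C.
Proof. by rewrite /nr RRe_real ?ger0_real. Qed.

Lemma nr_ge0 x : 0 <= nr x.
Proof. by rewrite -ler0c -nrE. Qed.

Lemma nr0 : nr (0 : E) = 0.
Proof. by rewrite /nr normr0. Qed.

Lemma nr_eq0 x : nr x = 0 -> x = 0.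
Proof. by move=> h; apply/normr0_eq0; rewrite nrE h. Qed.

Lemma nrN x : nr (- x) = nr x.
Proof. by rewrite /nr normrN. Qed.

Lemma nrD x y : nr (x + y) <= nr x + nr y.
Proof. by rewrite -lecR rmorphD /= -!nrE ler_normD. Qed.

Lemma nrB x y : nr (x - y) <= nr x + nr y.
Proof. by rewrite -(nrN y) nrD. Qed.

Lemma nrZ (z : R[i]) x : nr (z *: x) = Normc.normc z * nr x.
Proof.
rewrite -[Normc.normc z]/(complex.Re `|z|).
rewrite {1}/nr.
have {1}-> : `|z *: x| = (complex.Re `|z| * nr x)%:C; last by [].
by rewrite normrZ rmorphM /= -(nrE x).
Qed.

Lemma nrZ_real (t : R) x : 0 <= t -> nr (t%:C *: x) = t * nr x.
Proof. by move=> t0; rewrite nrZ /= expr0n addr0 sqrtr_sqr ger0_norm. Qed.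

Lemma nrZ_i x : nr ('i *: x) = nr x.
Proof. by rewrite nrZ /= expr0n expr1n add0r sqrtr1 mul1r. Qed.

Lemma nr_cvg (T : Type) (F : set_system T) {FF : Filter F} (u : T -> E) (l : E) :
  u @ F --> l <-> forall e : R, 0 < e -> \forall t \near F, nr (l - u t) < e.
Proof.
split.
  move=> /cvgrPdist_lt h e e0.
  have := h e%:C; rewrite ltcR => /(_ e0); apply: filterS => t.
  by rewrite nrE ltcR.
move=> h; apply/cvgrPdist_lt => e e0.
have eR : e = (complex.Re e)%:C by rewrite RRe_real ?gtr0_real.
rewrite eR ltcR in e0.
move: (h _ e0); apply: filterS => t.
by rewrite nrE eR ltcR.
Qed.

Lemma cvg_nr (T : Type) (F : set_system T) {FF : Filter F} (u : T -> E) (l : E)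
    (e : R) :
  u @ F --> l -> 0 < e -> \forall t \near F, nr (l - u t) < e.
Proof. by move=> /nr_cvg; apply. Qed.

End RealNorm.

Lemma nr_complete (R : realType) (E : completeNormedModType R[i])
    (T : Type) (F : set_system T) {FF : ProperFilter F} (u : T -> E) :
  (forall e : R, 0 < e -> exists l : E, \forall t \near F, nr (l - u t) < e) ->
  exists l : E, u @ F --> l.
Proof.
move=> h; apply/cvg_ex; apply/cauchy_cvgP; apply: cauchy_exP => e e0.
have eR : e = (complex.Re e)%:C by rewrite RRe_real ?gtr0_real.
have e0' := e0; rewrite eR ltcR in e0'.
have [l hl] := h _ e0'; exists l.
rewrite /fmap /=; move: hl; apply: filterS => t.
by rewrite -ball_normE /ball_ /= nrE eR ltcR.
Qed.

(** * Involution, norm and Neumann series in the algebra *)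

Section CStar.
Context {R : realType} {A : cstarAlgType R}.
Implicit Types a b x y : A.

Lemma scalerMl (z : R[i]) a b : z *: a * b = z *: (a * b).
Proof. by rewrite [RHS]cscaleAl. Qed.

Lemma scalerMr (z : R[i]) a b : a * (z *: b) = z *: (a * b).
Proof. by rewrite [RHS]cscaleAr. Qed.

Lemma starN a : star (- a) = - star a.
Proof. by rewrite -scaleN1r starZ rmorphN rmorph1 scaleN1r. Qed.

Lemma starB a b : star (a - b) = star a - star b.
Proof. by rewrite starD starN. Qed.

Lemma star_mul a b : star (a * b) = star b * star a.
Proof. exact: starM. Qed.

Lemma star1 : star 1 = 1 :> A.
Proof. by rewrite -[RHS]starK -[star 1 in RHS]mul1r star_mul starK mul1r. Qed.

Lemma star0 : star 0 = 0 :> A.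
Proof. by have := starB 0 0; rewrite !subrr. Qed.

Lemma starZ_real (t : R) a : star (t%:C *: a) = t%:C *: star a.
Proof. by rewrite starZ; congr (_ *: _); exact: conjc_real. Qed.

Lemma nrM a b : nr (a * b) <= nr a * nr b.
Proof. rewrite -lecR rmorphM /= -!nrE; exact: normM_le. Qed.

Lemma nr_starM a : nr (star a * a) = nr a ^+ 2.
Proof. apply: (@complexI R); rewrite rmorphXn /= -!nrE; exact: norm_starM. Qed.

(** The C*-identity makes this norm idempotent, hence 0 or 1; the value 0 occurs in the zero
    algebra. *)
Lemma nr1 : nr (1 : A) <= 1.
Proof.
have := nr_starM 1; rewrite star1 mulr1 => h.
have := nr_ge0 (1 : A); nra.
Qed.

Lemma nrX a n : nr (a ^+ n) <= nr a ^+ n.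
Proof.
elim: n => [|n ih]; first by rewrite !expr0 nr1.
by rewrite !exprS (le_trans (nrM _ _)) // ler_wpM2l ?nr_ge0.
Qed.

(** The geometric series is Cauchy, and its limit inverts [1 - x] on both sides by continuity of
    multiplication. *)
Lemma neumann x : nr x < 1 -> invertible (1 - x).
Proof.
move=> x1; set q := nr x in x1; have q0 : 0 <= q := nr_ge0 _.
pose u n : A := \sum_(i < n) x ^+ i.
have uM n : (1 - x) * u n = 1 - x ^+ n.
  by rewrite -[RHS]opprB subrX1 -mulNr opprB.
have uC n : u n * (1 - x) = (1 - x) * u n.
  apply: commr_sym; apply: commr_sum => i _; apply: commrX.
  by apply/commr_sym/commrB => //; apply: commr1.
have xn0 (e : R) : 0 < e -> \forall n \near \oo, q ^+ n < e.
  move=> e0; have /cvgrPdist_lt/(_ _ e0) := @cvg_expr R q ltac:(by rewrite ger0_norm).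
  by apply: filterS => n; rewrite sub0r normrN ger0_norm // exprn_ge0.
(* Scaled by [1 - q], the bound telescopes: the term [x ^+ (n + k)] contributes at most
   [q ^+ (n + k) - q ^+ (n + k).+1]. *)
have uB n k : (1 - q) * nr (u n - u (n + k)%N) <= q ^+ n - q ^+ (n + k).
  elim: k => [|k ih]; first by rewrite addn0 !subrr nr0 mulr0.
  rewrite addnS [u _.+1]big_ord_recr /= opprD addrA.
  apply: le_trans (ler_wpM2l _ (nrB _ _)) _; first lra.
  have := nrX x (n + k); rewrite -/q exprS -/(u _) => h.
  nra.
have [l ul] : exists l : A, u n @[n --> \oo] --> l.
  apply: nr_complete => e e0.
  have e1 : 0 < (1 - q) * e by rewrite mulr_gt0 // subr_gt0.
  have [n _ hn] := xn0 _ e1.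
  exists (u n); exists n => // m /= nm.
  have := uB n (m - n)%N; rewrite subnKC // => h.
  have := hn n (leqnn _) => /= h2.
  have : (1 - q) * nr (u n - u m) < (1 - q) * e.
    have : 0 <= q ^+ m by exact: exprn_ge0.
    lra.
  by rewrite ltr_pM2l // subr_gt0.
(* Left and right multiplication by [1 - x] are treated together, as Lipschitz maps compatible with
   differences. *)
have key (f : A -> A) : (forall a b, f (a - b) = f a - f b) ->
    (exists c, forall a, nr (f a) <= c * nr a) ->
    (forall n, f (u n) = 1 - x ^+ n) -> f l = 1.
  move=> fB [c fc] fu; apply/eqP; rewrite -subr_eq0; apply/eqP/nr_eq0.
  apply/eqP; rewrite eq_le nr_ge0 andbT; apply/ler_addgt0Pl => e e0.
  rewrite addr0.
  have c0 : 0 < `|c| + 1 by rewrite ltr_wpDl.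
  have e2 : 0 < e / (`|c| + 1) / 2 by rewrite !divr_gt0.
  have e3 : 0 < e / 2 by rewrite !divr_gt0.
  have /nr_cvg/(_ _ e2) [n1 _ h1] := ul.
  have [n2 _ h2] := xn0 _ e3.
  pose n := maxn n1 n2.
  have {}h1 := h1 n (leq_maxl _ _); have {}h2 := h2 n (leq_maxr _ _).
  have -> : f l - 1 = f (l - u n) - x ^+ n.
    by rewrite fB fu opprB [_ - 1 in RHS]addrC addrA addrK.
  rewrite (le_trans (nrB _ _)) //.
  have := fc (l - u n); have := nrX x n; rewrite -/q.
  have : c * nr (l - u n) <= e / 2.
    have : c * nr (l - u n) <= (`|c| + 1) * nr (l - u n).
      by rewrite ler_wpM2r ?nr_ge0 // (le_trans (ler_norm _)) // lerDl.
    move=> h3; apply: (le_trans h3); rewrite -ler_pdivlMl // mulrC.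
    by move: h1 => /= /ltW; rewrite mulrAC.
  move: h2 => /=; lra.
exists l; split.
  apply: (key (fun a => (1 - x) * a)) => [a b||n].
  - exact: mulrBr.
  - by exists (nr (1 - x)) => a; exact: nrM.
  - exact: uM.
apply: (key (fun a => a * (1 - x))) => [a b||n].
- exact: mulrBl.
- by exists (nr (1 - x)) => a; rewrite [leRHS]mulrC nrM.
- by rewrite uC uM.
Qed.
End CStar.

(** * Spectrum of self-adjoint elements and the norm criterion for positivity *)

Section Spectrum.
Context {R : realType} {A : cstarAlgType R}.
Implicit Types a b c d u x y : A.

Lemma nr_star a : nr (star a) = nr a.
Proof.
have le b : nr b <= nr (star b).
  have := nr_starM b; have := nrM (star b) b.
  have := nr_ge0 b; have := nr_ge0 (star b); nra.
by apply/le_anti; rewrite le /= -{2}(starK a) le.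
Qed.

Lemma invertibleN a : invertible a -> invertible (- a).
Proof. by move=> [b [h1 h2]]; exists (- b); rewrite !mulrNN. Qed.

Lemma invertibleZ (z : R[i]) a : z != 0 -> invertible a -> invertible (z *: a).
Proof.
move=> z0 [b [h1 h2]]; exists (z^-1 *: b).
by rewrite !scalerMl !scalerMr h1 h2 !scalerA divff // mulVf // scale1r.
Qed.

Lemma inverse_comm a b u : a * b = 1 -> b * a = 1 -> a * u = u * a -> b * u = u * b.
Proof.
move=> ab ba au.
rewrite -[b * u]mulr1 -ab -!mulrA [u * (a * b)]mulrA -au -mulrA.
by rewrite [b * (a * _)]mulrA ba mul1r.
Qed.

Lemma resolvent_large (z : R[i]) a : nr a < Normc.normc z -> invertible (z *: (1 : A) - a).
Proof.
move=> az; have z0 : z != 0.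
  by apply/eqP => z0; move: az; rewrite z0 Normc.normc0 ltNge nr_ge0.
have zp : 0 < Normc.normc z := le_lt_trans (nr_ge0 _) az.
have -> : z *: (1 : A) - a = z *: (1 - z^-1 *: a).
  by rewrite scalerBr scalerA divff // scale1r.
apply: invertibleZ => //; apply: neumann.
by rewrite nrZ Normc.normcV mulrC ltr_pdivrMr // mul1r.
Qed.

Lemma resolvent_largeR (t : R) a : nr a < t -> invertible (t%:C *: (1 : A) - a).
Proof.
move=> at0; apply: resolvent_large.
by rewrite /= expr0n addr0 sqrtr_sqr (lt_le_trans at0) ?ler_norm.
Qed.

Lemma sub_add_scalar x (z : R[i]) :
  (x - z *: (1 : A)) * (x + z *: (1 : A)) = x * x - z ^+ 2 *: (1 : A).
Proof.
rewrite mulrBl !mulrDr !scalerMl !scalerMr !mul1r !mulr1 scalerA -expr2.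
by rewrite opprD addrA addrK.
Qed.

(** Shift both [z = al + i be] and [x] by [i tau]. The shifted element has squared norm at most
    [|x|^2 + tau^2], and the choice [2 be tau = |x|^2] makes this smaller than
    [al^2 + (be + tau)^2]. *)
Lemma sa_resolvent x (z : R[i]) :
  star x = x -> complex.Im z != 0 -> invertible (z *: (1 : A) - x).
Proof.
move=> xs; case: z => al be /= be0.
pose tau := nr x ^+ 2 / (2 * be).
have -> : (al +i* be) *: (1 : A) - x
    = (al +i* (be + tau)) *: (1 : A) - (x + (0 +i* tau) *: (1 : A)).
  have -> : al +i* (be + tau) = al +i* be + 0 +i* tau by simpc.
  by rewrite scalerDl opprD addrACA subrr addr0.
apply: resolvent_large => /=.
have h : nr (x + (0 +i* tau) *: (1 : A)) ^+ 2 <= nr x ^+ 2 + tau ^+ 2.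
  rewrite -nr_starM starD xs starZ star1.
  have -> : (Num.conj (0 +i* tau) : R[i]) = - (0 +i* tau).
    by rewrite -[Num.conj _]/((0 +i* tau)^*) /=; simpc.
  rewrite scaleNr sub_add_scalar (le_trans (nrB _ _)) //.
  have -> : (0 +i* tau) ^+ 2 = - (tau ^+ 2)%:C by rewrite expr2; simpc.
  rewrite scaleNr nrN nrZ_real ?sqr_ge0 // lerD //.
    by rewrite -{1}xs nr_starM.
  by rewrite ler_piMr ?sqr_ge0 ?nr1.
rewrite -(ltr_pXn2r (ltn0Sn 1)) ?nnegrE ?nr_ge0 ?sqrtr_ge0 //.
rewrite sqr_sqrtr ?addr_ge0 ?sqr_ge0 // (le_lt_trans h) //.
have -> : nr x ^+ 2 = 2 * be * tau by rewrite /tau; field.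
have : 0 < be ^+ 2 by rewrite lt0r sqrf_eq0 be0 sqr_ge0.
have := sqr_ge0 al; nra.
Qed.

(* [v = (x + i) (x - i)^-1] is unitary and its imaginary part is
   [2 x (1 + x^2)^-1]. *)
Lemma sa_cayley x : star x = x -> nr x <= 1 ->
  exists d, [/\ d * (1 + x * x) = 1, (1 + x * x) * d = 1 & nr (x * x * d) <= 2^-1].
Proof.
move=> xs x1.
have [b [b1 b2]] : invertible ((0 +i* 1) *: (1 : A) - x).
  by apply: sa_resolvent => //=; rewrite oner_eq0.
pose I : A := (0 +i* 1) *: (1 : A).
have Is : star I = - I.
  rewrite /I starZ star1 -[Num.conj _]/((0 +i* 1)^*) -scaleNr; congr (_ *: _).
  by simpc.
pose p := - b; pose q := star p.
have p1 : (x - I) * p = 1 by rewrite /p -opprB mulrNN.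
have p2 : p * (x - I) = 1 by rewrite /p -opprB mulrNN.
have xIs : star (x - I) = x + I by rewrite starB xs Is opprK.
have xIs' : star (x + I) = x - I by rewrite starD xs Is.
have q1 : q * (x + I) = 1 by rewrite /q -xIs -star_mul p1 star1.
have q2 : (x + I) * q = 1 by rewrite /q -xIs -star_mul p2 star1.
have I2 : ((0 +i* 1) ^+ 2 : R[i]) = -1 by rewrite expr2; simpc.
have f1 : (x - I) * (x + I) = 1 + x * x.
  by rewrite sub_add_scalar I2 scaleN1r opprK addrC.
have f2 : (x + I) * (x - I) = 1 + x * x.
  rewrite -[x + I](_ : x - (- (0 +i* 1)) *: (1 : A) = _); last by rewrite scaleNr opprK.
  rewrite -[x - I](_ : x + (- (0 +i* 1)) *: (1 : A) = _); last by rewrite scaleNr.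
  by rewrite sub_add_scalar sqrrN I2 scaleN1r opprK addrC.
pose d := p * q.
exists d.
have d1 : d * (1 + x * x) = 1.
  by rewrite -f2 /d -mulrA [q * _]mulrA q1 mul1r.
have d2 : (1 + x * x) * d = 1.
  by rewrite -f2 /d -mulrA [_ * (p * q)]mulrA p1 mul1r.
have IC y : I * y = y * I by rewrite /I scalerMl scalerMr mul1r mulr1.
have px : p * x = x * p.
  by apply: (inverse_comm p1 p2); rewrite mulrBl mulrBr IC.
pose v := (x + I) * p.
have vs : star v = q * (x - I) by rewrite /v star_mul xIs'.
have v1 : nr v <= 1.
  have : star v * v = 1.
    by rewrite vs /v mulrA -[q * _ * _]mulrA f1 -f2 -!mulrA p1 mulr1 q1.
  move=> vv; have := nr_starM v; rewrite vv.
  have := nr1 (A := A); have := nr_ge0 v; nra.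
have pq : p + q = 2%:R *: (x * d).
  have -> : p + q = p * (x + I) * q + p * (x - I) * q.
    by rewrite -mulrA q2 p2 mulr1 mul1r.
  rewrite -mulrDl -mulrDr addrACA subrr addr0 -[x + x]mulr2n.
  by rewrite mulrnAr mulrnAl px /d mulrA scaler_nat.
have vE : v = 1 + 2%:R *: (I * p).
  have xI : x + I = x - I + I *+ 2 by rewrite mulr2n addrA addrNK.
  by rewrite /v xI mulrDl p1 mulrnAl scaler_nat.
have vsE : star v = 1 - 2%:R *: (I * q).
  rewrite vE starD star1 starZ star_mul Is -/q mulrN -IC scalerN.
  by congr (_ - _ *: _); exact: conjc_nat.
have vv : v - star v = 4%:R *: (I * (x * d)).
  rewrite vsE vE opprB addrC addrA addrNK addrC -scalerDr -mulrDr pq.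
  by rewrite scalerMr scalerA -natrM.
split=> //.
(* As [v] and [star v] have norm at most 1, their difference has norm at most 2. *)
have h : 4 * nr (x * d) <= 2.
  have <- : nr (v - star v) = 4 * nr (x * d).
    rewrite vv -(rmorph_nat (real_complex R)) nrZ_real // scalerMl nrZ_i mul1r.
    by [].
  apply: le_trans (nrB _ _) _; rewrite nr_star; lra.
rewrite -mulrA; apply: le_trans (nrM _ _) _.
have := nr_ge0 (x * d); have := nr_ge0 x; nra.
Qed.

(* With [y = x^2], [y^2 (1 - y^2)^-1 = y (1 - y)^-1 * y (1 + y)^-1] has at most
   half the norm of [y (1 - y)^-1]. *)
Lemma sa_unit_iter n x c : star x = x -> nr x = 1 ->
  c * (1 - x * x) = 1 -> (1 - x * x) * c = 1 -> 2 ^+ n <= 2 * nr (x * x * c).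
Proof.
have nxx y : star y = y -> nr y = 1 -> nr (y * y) = 1.
  by move=> ys y1; rewrite -{1}ys nr_starM y1 expr1n.
elim: n x c => [|n ih] x c xs x1 c1 c2.
  (* Base case: [x^2 = x^2 c (1 - x^2)] has norm 1, and the last factor has norm at most 2. *)
  have := nrM (x * x * c) (1 - x * x); rewrite -mulrA c1 mulr1 nxx //.
  have := nrB (1 : A) (x * x); rewrite nxx //; have := nr1 (A := A).
  have := nr_ge0 (x * x * c); have := nr_ge0 (1 - x * x).
  rewrite expr0; nra.
have [d [d1 d2 d3]] := sa_cayley xs ltac:(by rewrite x1).
set y := x * x in c1 c2 d1 d2 d3 *.
have ys : star y = y by rewrite /y star_mul xs.
have y1 : nr y = 1 by exact: nxx.
clearbody y.
have f1 : (1 - y) * (1 + y) = 1 - y * y.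
  by rewrite mulrBl !mulrDr !mul1r !mulr1 opprD addrA addrK.
have f2 : (1 + y) * (1 - y) = 1 - y * y.
  by rewrite mulrDl !mulrBr !mul1r !mulr1 addrA addrNK.
(* The induction hypothesis is taken at [y], where [c * d] inverts [1 - y^2 = (1 + y) (1 - y)]. *)
have := ih y (c * d) ys y1; rewrite -{1}f2 -{1}f2.
rewrite -!mulrA [d * (_ * _)]mulrA d1 mul1r [(1 - y) * (c * d)]mulrA c2 mul1r.
move=> /(_ c1 d2).
have yc : c * y = y * c by apply: (inverse_comm c2 c1); rewrite mulrBl mulrBr mul1r mulr1.
rewrite [y * (c * d)]mulrA -yc -[c * y * d]mulrA [y * (c * _)]mulrA.
have := nrM (y * c) (y * d).
have := nr_ge0 (y * c); have := nr_ge0 (y * d).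
by rewrite exprS yc; nra.
Qed.

(** The inverse of [1 - x^2] would satisfy the bound of [sa_unit_iter] for every [n], while [2 ^+ n]
    is unbounded. *)
Lemma sa_unit_not_invertible x : star x = x -> nr x = 1 ->
  invertible (1 - x) -> invertible (1 + x) -> False.
Proof.
move=> xs x1 [b [b1 b2]] [c [c1 c2]].
have f1 : (1 - x) * (1 + x) = 1 - x * x.
  by rewrite mulrBl !mulrDr !mul1r !mulr1 opprD addrA addrK.
have f2 : (1 + x) * (1 - x) = 1 - x * x.
  by rewrite mulrDl !mulrBr !mul1r !mulr1 addrA addrNK.
have h n := @sa_unit_iter n x (b * c) xs x1.
have e1 : b * c * (1 - x * x) = 1 by rewrite -f2 -mulrA [c * _]mulrA c2 mul1r.
have e2 : (1 - x * x) * (b * c) = 1 by rewrite -f2 -mulrA [_ * (b * c)]mulrA b1 mul1r.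
pose M := 2 * nr (x * x * (b * c)).
have M0 : 0 <= M by rewrite mulr_ge0 ?nr_ge0.
have := archi_boundP M0; set n := Num.bound _ => hn.
have := h n e1 e2; rewrite -/M leNgt => /negP; apply.
by rewrite (lt_trans hn) // -natrX ltr_nat ltn_expl.
Qed.

(** Rescaling reduces to norm 1. This stands in for the spectral radius formula. *)
Lemma sa_norm_spectrum x : star x = x -> 0 < nr x ->
  invertible ((nr x)%:C *: (1 : A) - x) -> invertible ((nr x)%:C *: (1 : A) + x) -> False.
Proof.
move=> xs x0 i1 i2; set t := nr x in x0 i1 i2.
have tV : (t^-1%:C * t%:C)%R = 1 :> R[i] by rewrite -rmorphM /= mulVf ?gt_eqF.
have tV0 : t^-1%:C != 0 :> R[i] by rewrite fmorph_eq0 invr_eq0 gt_eqF.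
apply: (@sa_unit_not_invertible (t^-1%:C *: x)).
- by rewrite starZ_real xs.
- by rewrite nrZ_real ?invr_ge0 ?ltW // mulVf ?gt_eqF.
- by have := invertibleZ tV0 i1; rewrite scalerBr scalerA tV scale1r.
- by have := invertibleZ tV0 i2; rewrite scalerDr scalerA tV scale1r.
Qed.

(** Together with [bound_cstar_pos], this turns positivity into a norm inequality. If [x = t - a]
    had norm [n > t], then [n - x] would be invertible because [t - n < 0] is off the spectrum of
    [a], and [n + x] because [n + t > |a|]. *)
Lemma cstar_pos_bound a (t : R) : cstar_pos a -> nr a <= t -> nr (t%:C *: (1 : A) - a) <= t.
Proof.
move=> [sa pa] at0; rewrite leNgt; apply/negP => tn.
have t0 : 0 <= t := le_trans (nr_ge0 _) at0.
set x := t%:C *: (1 : A) - a in tn; set n := nr x in tn.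
apply: (@sa_norm_spectrum x); first by rewrite /x starB starZ_real star1 sa.
- exact: le_lt_trans tn.
- have -> : n%:C *: (1 : A) - x = - ((t - n)%:C *: (1 : A) - a).
    by rewrite rmorphB scalerBl /x !opprB addrCA.
  apply: invertibleN; apply: contrapT => /pa /=; rewrite ler0c subr_ge0.
  by rewrite leNgt tn.
- rewrite -/n /x addrA -scalerDl -rmorphD.
  by apply: resolvent_largeR; rewrite (le_lt_trans at0) // ltrDr (le_lt_trans t0).
Qed.

(** Non-real points are excluded by [sa_resolvent]; for [s < 0], the number [t - s] exceeds the norm
    of [t - a]. *)
Lemma bound_cstar_pos a (t : R) : star a = a -> nr (t%:C *: (1 : A) - a) <= t -> cstar_pos a.
Proof.
move=> sa h; split=> // z; apply: contra_notP => z0.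
have [im0|] := eqVneq (complex.Im z) 0; last exact: sa_resolvent.
case: z im0 z0 => s _ /= ->; rewrite [_ +i* _]complexr0 => s0.
have {}s0 : s < 0 by rewrite ltNge -ler0c; apply/negP.
have -> : s%:C *: (1 : A) - a = - ((t - s)%:C *: (1 : A) - (t%:C *: (1 : A) - a)).
  by rewrite rmorphB scalerBl !opprB [RHS]addrC addrA addrNK.
apply/invertibleN/resolvent_largeR; rewrite (le_lt_trans h) //; lra.
Qed.

End Spectrum.

(** * The positive elements form a closed convex cone on which the norm is monotone *)

Section Cone.
Context {R : realType} {A : cstarAlgType R}.
Implicit Types a b c d u x y : A.

Lemma cstar_pos_bound_nr a : cstar_pos a -> nr ((nr a)%:C *: (1 : A) - a) <= nr a.
Proof. by move=> pa; apply: cstar_pos_bound. Qed.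

Lemma cstar_pos0 : cstar_pos (0 : A).
Proof.
by apply: (@bound_cstar_pos _ _ _ 0); rewrite ?star0 // scale0r subrr nr0.
Qed.

Lemma cstar_posD a b : cstar_pos a -> cstar_pos b -> cstar_pos (a + b).
Proof.
move=> pa pb; apply: (@bound_cstar_pos _ _ _ (nr a + nr b)).
  by rewrite starD pa.1 pb.1.
rewrite rmorphD scalerDl opprD addrACA (le_trans (nrD _ _)) //.
by rewrite lerD // cstar_pos_bound_nr.
Qed.

Lemma cstar_posZ (t : R) a : 0 <= t -> cstar_pos a -> cstar_pos (t%:C *: a).
Proof.
move=> t0 pa; apply: (@bound_cstar_pos _ _ _ (t * nr a)); first by rewrite starZ_real pa.1.
rewrite rmorphM -scalerA -scalerBr nrZ_real // ler_wpM2l //.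
exact: cstar_pos_bound_nr.
Qed.

Lemma cstar_posZ_inv (t : R) a : 0 < t -> cstar_pos (t%:C *: a) -> cstar_pos a.
Proof.
move=> t0 /(@cstar_posZ t^-1); rewrite invr_ge0 ltW // scalerA -rmorphM /=.
by rewrite mulVf ?gt_eqF // scale1r; apply.
Qed.

Lemma cstar_pos_sum (I : Type) (s : seq I) (F : I -> A) :
  (forall i, cstar_pos (F i)) -> cstar_pos (\sum_(i <- s) F i).
Proof.
move=> h; elim/big_ind: _ => //; first exact: cstar_pos0.
exact: cstar_posD.
Qed.

Lemma cstar_pos_closed a :
  (forall e : R, 0 < e -> exists2 b, cstar_pos b & nr (a - b) <= e) -> cstar_pos a.
Proof.
move=> h; apply: (@bound_cstar_pos _ _ _ (nr a + 1)).
  apply/eqP; rewrite -subr_eq0; apply/eqP/nr_eq0/le_anti; rewrite nr_ge0 andbT.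
  apply/ler_addgt0Pl => e e0; rewrite addr0.
  have [b pb ab] := h (e / 2) ltac:(by rewrite divr_gt0).
  have -> : star a - a = star (a - b) - (a - b) by rewrite starB pb.1 opprB addrA addrNK.
  apply: le_trans (nrB _ _) _; rewrite nr_star; lra.
apply/ler_addgt0Pl => e e0.
(* The minimum with 1 keeps [nr b] below [nr a + 1], a value independent of [e]. *)
have m0 : 0 < Num.min e 1 by rewrite lt_min e0 ltr01.
have [b pb ab] := h _ m0.
have me : Num.min e 1 <= e by rewrite ge_min lexx.
have m1 : Num.min e 1 <= 1 by rewrite ge_min lexx orbT.
set t := nr a + 1.
have bt : nr b <= t.
  have -> : b = a - (a - b) by rewrite opprB addrC addrNK.
  apply: le_trans (nrB _ _) _; rewrite /t; lra.
have -> : t%:C *: (1 : A) - a = t%:C *: (1 : A) - b - (a - b).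
  by rewrite opprB addrA addrNK.
apply: le_trans (nrB _ _) _.
have := cstar_pos_bound pb bt; lra.
Qed.

(** From [y <= t = |y|] follows [x <= t]. If [n = |x|] exceeded [t], neither [n] nor [-n] would be
    in the spectrum of [x]. *)
Lemma cstar_pos_le_nr x y : cstar_pos x -> cstar_pos (y - x) -> nr x <= nr y.
Proof.
move=> px pyx; rewrite leNgt; apply/negP; set t := nr y; set n := nr x => tn.
have py : cstar_pos y by rewrite -(subrK x y); apply: cstar_posD.
have pty : cstar_pos (t%:C *: (1 : A) - y).
  apply: (@bound_cstar_pos _ _ _ t); first by rewrite starB starZ_real star1 py.1.
  by rewrite opprB addrC addrNK.
have ptx : cstar_pos (t%:C *: (1 : A) - x).
  by rewrite -(subrK y (t%:C *: _)) -addrA; apply: cstar_posD.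
apply: (@sa_norm_spectrum _ _ x px.1).
- exact: le_lt_trans (nr_ge0 _) tn.
- have -> : (nr x)%:C *: (1 : A) - x = - ((t - n)%:C *: (1 : A) - (t%:C *: (1 : A) - x)).
    by rewrite rmorphB scalerBl !opprB [RHS]addrC addrA addrNK.
  apply: invertibleN; apply: contrapT => /ptx.2 /=; rewrite ler0c subr_ge0.
  by rewrite leNgt tn.
- have -> : (nr x)%:C *: (1 : A) + x = - ((- n)%:C *: (1 : A) - x).
    by rewrite rmorphN scaleNr opprB addrC opprK.
  apply: invertibleN; apply: contrapT => /px.2 /=; rewrite ler0c oppr_ge0.
  by rewrite leNgt (le_lt_trans _ tn) // nr_ge0.
Qed.
End Cone.

(** * Inner product calculus and polarization of [A]-valued forms *)

Section HilbertModule.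
Context {R : realType} {A : cstarAlgType R} {H : hilbertModType A}.
Implicit Types (f g h : H) (T P X Y K : H -> H) (z : R[i]).
Local Notation "<< f , g >>" := (inner f g).

Lemma innerZl z f g : << z *: f, g >> = z *: << f, g >>.
Proof. by rewrite -amul_scalar inner_amul scalerMl mul1r. Qed.

Lemma innerDr f g h : << f, g + h >> = << f, g >> + << f, h >>.
Proof. by rewrite ![<< f, _ >>]inner_star innerDl starD. Qed.

Lemma innerZr z f g : << f, z *: g >> = (z^*) *: << f, g >>.
Proof. by rewrite ![<< f, _ >>]inner_star innerZl starZ. Qed.

Lemma innerNl f g : << - f, g >> = - << f, g >>.
Proof. by rewrite -scaleN1r innerZl scaleN1r. Qed.

Lemma innerNr f g : << f, - g >> = - << f, g >>.
Proof. by rewrite ![<< f, _ >>]inner_star innerNl starN. Qed.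

Lemma innerBl f g h : << f - g, h >> = << f, h >> - << g, h >>.
Proof. by rewrite innerDl innerNl. Qed.

Lemma innerBr f g h : << f, g - h >> = << f, g >> - << f, h >>.
Proof. by rewrite innerDr innerNr. Qed.

Lemma inner0l f : << 0, f >> = 0.
Proof. by rewrite -[0](subrr f) innerBl subrr. Qed.

Lemma inner_suml (I : Type) (s : seq I) (F : I -> H) g :
  << \sum_(i <- s) F i, g >> = \sum_(i <- s) << F i, g >>.
Proof.
elim/big_rec2: _ => [|i x y _ <-]; first exact: inner0l.
by rewrite innerDl.
Qed.

Lemma nr_inner f : nr << f, f >> = nr f ^+ 2.
Proof.
apply: (@complexI R); rewrite rmorphXn /= -!nrE.
by rewrite norm_inner sqrtCK.
Qed.

Lemma inner_ext f g : (forall h, << f, h >> = << g, h >>) -> f = g.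
Proof.
move=> e; apply/eqP; rewrite -subr_eq0; apply/eqP/nr_eq0.
have := nr_inner (f - g); rewrite innerBl e subrr nr0 => /esym/eqP.
by rewrite sqrf_eq0 => /eqP.
Qed.

(** One polarization argument serves [inner], [<< T f, g >>] and the symmetry defect
    [<< T f, g >> - << f, T g >>]. *)
Record sesquilinear (B : H -> H -> A) : Prop := Sesquilinear {
  sesqDl : forall f g h, B (f + g) h = B f h + B g h;
  sesqDr : forall f g h, B f (g + h) = B f g + B f h;
  sesqZl : forall z f g, B (z *: f) g = z *: B f g;
  sesqZr : forall z f g, B f (z *: g) = (z^*) *: B f g
}.

Lemma sesq_polar (B : H -> H -> A) f g : sesquilinear B ->
  (4 : R)%:C *: B f g =
    B (f + g) (f + g) - B (f - g) (f - g)
    + 'i *: (B (f + 'i *: g) (f + 'i *: g) - B (f - 'i *: g) (f - 'i *: g)).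
Proof.
move=> [Dl Dr Zl Zr].
have Nl u v : B (- u) v = - B u v by rewrite -scaleN1r Zl scaleN1r.
have Nr u v : B u (- v) = - B u v.
  by rewrite -scaleN1r Zr rmorphN rmorph1 scaleN1r.
have dif u : B (f + u) (f + u) - B (f - u) (f - u) = (B f u + B u f) *+ 2.
  rewrite !Dl !Dr !Nl !Nr opprK opprD addrACA opprB opprD opprK.
  rewrite [B u f + _ + _]addrACA subrr addr0 [B f f + _]addrC.
  rewrite [B f u + B f f + _]addrACA subrr addr0.
  by rewrite -!mulr2n -mulrnDl.
have ic : Num.conj ('i : R[i]) = - 'i by rewrite -[Num.conj _]/('i^*); simpc.
have ii : 'i * 'i = -1 :> R[i] by simpc.
rewrite !dif Zl Zr ic scaleNr -scalerMnr scalerDr scalerN !scalerA ii !scaleN1r opprK.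
rewrite -mulrnDl addrACA subrr addr0 -mulr2n -mulrnA -[RHS]scaler_nat.
by congr (_ *: _); exact: rmorph_nat.
Qed.

(** Polarization bounds [B f g] by [b (|f| + |g|)^2]; rescaling [g] to the norm of [f] turns this
    into a product. *)
Lemma sesq_bound (B : H -> H -> A) (b : R) : sesquilinear B ->
  (forall f, nr (B f f) <= b * nr f ^+ 2) ->
  forall f g, nr (B f g) <= 4 * b * nr f * nr g.
Proof.
move=> sB bB.
have add f g : 0 <= b -> nr (B f g) <= b * (nr f + nr g) ^+ 2.
  move=> b0.
  have q u : nr u <= nr f + nr g -> nr (B u u) <= b * (nr f + nr g) ^+ 2.
    move=> h; rewrite (le_trans (bB u)) // ler_wpM2l //.
    by rewrite lerXn2r ?nnegrE ?addr_ge0 ?nr_ge0.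
  have gi : nr ('i *: g) = nr g by exact: nrZ_i.
  have h1 := q _ (nrD f g); have h2 := q _ (nrB f g).
  have h3 := q (f + 'i *: g) ltac:(by rewrite -gi nrD).
  have h4 := q (f - 'i *: g) ltac:(by rewrite -gi nrB).
  have : nr ((4 : R)%:C *: B f g) <= 4 * (b * (nr f + nr g) ^+ 2).
    rewrite sesq_polar //; apply: le_trans (nrD _ _) _; rewrite nrZ_i.
    have := nrB (B (f + g) (f + g)) (B (f - g) (f - g)).
    have := nrB (B (f + 'i *: g) (f + 'i *: g)) (B (f - 'i *: g) (f - 'i *: g)).
    lra.
  rewrite nrZ_real //; lra.
move=> f g.
have B0l u : B 0 u = 0 by have := sesqZl sB 0 0 u; rewrite !scale0r.
have B0r u : B u 0 = 0 by have := sesqZr sB 0 u 0; rewrite rmorph0 !scale0r.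
have [f0|f0] := eqVneq (nr f) 0.
  by rewrite (nr_eq0 f0) B0l !nr0 mulr0 mul0r.
have [g0|g0] := eqVneq (nr g) 0.
  by rewrite (nr_eq0 g0) B0r !nr0 mulr0.
have fp : 0 < nr f by rewrite lt0r f0 nr_ge0.
have gp : 0 < nr g by rewrite lt0r g0 nr_ge0.
have b0 : 0 <= b.
  have := le_trans (nr_ge0 _) (bB f); rewrite pmulr_lge0 // exprn_gt0 //.
have s0 : 0 <= nr f / nr g by rewrite divr_ge0 // ltW.
have := add f ((nr f / nr g)%:C *: g) b0.
rewrite (sesqZr sB) [Num.conj _](conjc_real) !nrZ_real // divfK //.
rewrite mulrAC ler_pdivrMr // => h.
by rewrite -(ler_pM2l fp); apply: le_trans h _; lra.
Qed.

End HilbertModule.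

(** * Symmetric and positive operators and their order *)

Section SymmetricOperators.
Context {R : realType} {A : cstarAlgType R} {H : hilbertModType A}.
Implicit Types (f g h : H) (T P X Y K : H -> H) (z : R[i]) (M : R).
Local Notation "<< f , g >>" := (inner f g).

(** Cauchy-Schwarz up to the factor 4 of polarization. *)
Lemma nr_inner_le f g : nr << f, g >> <= 4 * nr f * nr g.
Proof.
have := @sesq_bound _ _ _ (@inner R A H) 1; rewrite mulr1; apply.
  by split=> *; rewrite ?innerDl ?innerDr ?innerZl ?innerZr.
by move=> h; rewrite nr_inner mul1r.
Qed.

Lemma scale2r (x : A) : (2 : R)%:C *: x = x + x.
Proof. by rewrite (rmorph_nat (real_complex R)) scaler_nat mulr2n. Qed.

Lemma scale_invK (t : R) (x : A) : t != 0 -> t%:C *: (t^-1%:C *: x) = x.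
Proof.
move=> t0; rewrite scalerA.
have -> : t%:C * t^-1%:C = 1 :> R[i] by rewrite -rmorphM /= mulfV.
exact: scale1r.
Qed.

(** Definiteness of the inner product makes such a map linear, so plain functions are enough. *)
Definition sym_op T := forall f g, << T f, g >> = << f, T g >>.

Lemma sym_opD T f g : sym_op T -> T (f + g) = T f + T g.
Proof. by move=> sT; apply: inner_ext => h; rewrite sT !innerDl !sT. Qed.

Lemma sym_opZ T z f : sym_op T -> T (z *: f) = z *: T f.
Proof. by move=> sT; apply: inner_ext => h; rewrite sT !innerZl !sT. Qed.

Lemma sym_opB T f g : sym_op T -> T (f - g) = T f - T g.
Proof. by move=> sT; apply: inner_ext => h; rewrite sT !innerBl !sT. Qed.

Lemma sym_op_comp T P : sym_op T -> sym_op P -> (forall f, T (P f) = P (T f)) ->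
  sym_op (fun f => T (P f)).
Proof. by move=> sT sP TP f g; rewrite sT sP TP. Qed.

Lemma sym_op_iter T n : sym_op T -> sym_op (iter n T).
Proof.
move=> sT; elim: n => [|n ih] // f g.
by rewrite iterS sT ih -iterSr.
Qed.

Lemma sym_opBr T P : sym_op T -> sym_op P -> sym_op (fun f => T f - P f).
Proof. by move=> sT sP f g; rewrite innerBl innerBr sT sP. Qed.

Lemma innerZr_real (t : R) f g : << f, t%:C *: g >> = t%:C *: << f, g >>.
Proof. by rewrite innerZr [Num.conj _](conjc_real). Qed.

Lemma sym_op_scale (t : R) T : sym_op T -> sym_op (fun f => t%:C *: T f).
Proof. by move=> sT f g; rewrite innerZl innerZr_real sT. Qed.

(** Each [<< T f, f >>] is self-adjoint, so the symmetry defect vanishes on the diagonal and, by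
    [sesq_bound] with [b = 0], everywhere. *)
Lemma pos_op_sym (T : {linear H -> H}) : pos_op T -> sym_op T.
Proof.
move=> pT f g.
pose B f g := << T f, g >> - << f, T g >>.
suff : nr (B f g) <= 4 * 0 * nr f * nr g.
  rewrite mulr0 !mul0r => h; apply/eqP; rewrite -subr_eq0; apply/eqP/nr_eq0.
  by apply/le_anti; rewrite h nr_ge0.
apply: sesq_bound => [|{}f].
  split=> *; rewrite /B ?(linearD T) ?(linearZ_LR T) ?innerDl ?innerDr ?innerZl ?innerZr.
  - by rewrite opprD addrACA.
  - by rewrite opprD addrACA.
  - by rewrite scalerBr.
  - by rewrite scalerBr.
by rewrite mul0r /B [<< f, _ >>]inner_star (pT f).1 subrr nr0.
Qed.

(** Apply [sesq_bound] at [g = T f] and cancel one factor [|T f|]. *)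
Lemma sym_op_bound T (b : R) : sym_op T ->
  (forall f, nr << T f, f >> <= b * nr f ^+ 2) -> forall f, nr (T f) <= 4 * b * nr f.
Proof.
move=> sT h f.
have [->|T0] := eqVneq (nr (T f)) 0.
  have [->|f0] := eqVneq (nr f) 0; first by rewrite mulr0.
  have fp : 0 < nr f by rewrite lt0r f0 nr_ge0.
  have := le_trans (nr_ge0 _) (h f).
  by rewrite pmulr_lge0 ?exprn_gt0 // => b0; rewrite !mulr_ge0 ?nr_ge0.
have Tp : 0 < nr (T f) by rewrite lt0r T0 nr_ge0.
have sB : sesquilinear (fun f g => << T f, g >>).
  split=> *; rewrite ?(sym_opD _ _ sT) ?(sym_opZ _ _ sT).
  - exact: innerDl. - exact: innerDr. - exact: innerZl. - exact: innerZr.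
have := sesq_bound sB h f (T f); rewrite nr_inner expr2.
by rewrite ler_pM2r.
Qed.

(* Expanding [0 <= <P (f - X f), f - X f>] gives [2 P X <= P + P X^2]; iterating
   along [X, X^2, X^4, ...] yields [P X <= P], as [P X^(2^n) / 2^n] tends to [0]. *)
Lemma pos_op_contraction P X : sym_op P -> pos_op P -> sym_op X ->
  (forall f, nr (X f) <= nr f) -> (forall f, P (X f) = X (P f)) ->
  forall f, cstar_pos (<< P f, f >> - << P (X f), f >>).
Proof.
move=> sP pP sX cX PX f.
(* [K] bounds the error before any iteration; each squaring of [X] halves it. *)
pose K := 8 * nr f * nr (P f).
have K0 : 0 <= K by rewrite !mulr_ge0 ?nr_ge0.
have step n : exists2 r, nr r <= K / 2 ^+ n &
    cstar_pos (<< P f, f >> - << P (X f), f >> + r).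
  elim: n X sX cX PX => [|n ih] X sX cX PX.
    exists (<< P (X f), f >> - << P f, f >>); last first.
      by rewrite addrA addrNK subrr; exact: cstar_pos0.
    rewrite expr0 divr1 (le_trans (nrB _ _)) //.
    have := nr_inner_le (P f) (X f); rewrite -sX -PX.
    have := nr_inner_le (P f) f.
    have : 4 * nr (P f) * nr (X f) <= 4 * nr (P f) * nr f.
      by rewrite ler_wpM2l ?cX // mulr_ge0 ?nr_ge0.
    rewrite /K; lra.
  (* At [X^2] the induction hypothesis reads [P X^2 <= P + r], whence
     [2 P X <= P + P X^2 <= 2 P + r]. *)
  have [r r1 r2] := ih (fun f => X (X f)) (sym_op_comp sX sX (fun=> erefl))
    (fun f => le_trans (cX _) (cX f)) ltac:(by move=> g; rewrite !PX).
  exists ((2^-1)%:C *: r).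
    by rewrite nrZ_real ?invr_ge0 // exprS invfM; lra.
  apply: (@cstar_posZ_inv _ _ 2) => //.
  have := cstar_posD (pP (f - X f)) r2; congr cstar_pos.
  rewrite (sym_opB _ _ sP) !(innerBl, innerBr).
  rewrite -[<< P f, X f >>]sX -PX -[<< P (X f), X f >>]sX -PX.
  rewrite scalerDr scale_invK ?pnatr_eq0 // scale2r opprB addrA.
  congr (_ + r); rewrite -addrA; congr (_ + _).
  by rewrite addrC addrA addrNK.
apply: cstar_pos_closed => e e0.
have [n Kn] : exists n, K / 2 ^+ n <= e.
  exists (Num.bound (K / e)); rewrite ler_pdivrMr ?exprn_gt0 // -ler_pdivrMl // mulrC.
  apply/ltW/(lt_le_trans (archi_boundP _)); first by rewrite divr_ge0 // ltW.
  by rewrite -natrX ler_nat ltnW // ltn_expl.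
have [r r1 r2] := step n; exists (<< P f, f >> - << P (X f), f >> + r) => //.
by rewrite opprD addrA subrr add0r nrN (le_trans r1).
Qed.

Lemma pos_op_id : pos_op (fun f : H => f).
Proof. exact: inner_pos. Qed.

Lemma contraction_pos X f : sym_op X -> (forall f, nr (X f) <= nr f) ->
  cstar_pos (<< f, f >> - << X f, f >>).
Proof.
by move=> sX cX; apply: (@pos_op_contraction (fun f => f)) => //; apply: pos_op_id.
Qed.

(** The order interval from 0 to 1 for quadratic forms. *)
Definition effect X := [/\ sym_op X, pos_op X
  & forall f, cstar_pos (<< f, f >> - << X f, f >>)].

Lemma effect_compl X : effect X -> effect (fun f => f - X f).
Proof.
move=> [sX pX lX]; split.
- exact: sym_opBr.
- by move=> f; rewrite innerBl.
- by move=> f; rewrite innerBl opprB addrC addrNK.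
Qed.

(* [X - X^2 = (1 - X) X (1 - X) + X (1 - X) X] *)
Lemma effect_sqr X f : effect X -> cstar_pos (<< X f, f >> - << X f, X f >>).
Proof.
move=> [sX pX lX]; have := cstar_posD (pX (f - X f)) (lX (X f)).
congr cstar_pos.
rewrite (sym_opB _ _ sX) !(innerBl, innerBr) [<< X (X f), f >>]sX.
by rewrite addrNK.
Qed.

(** Use [X^2 <= X <= 1] and monotonicity of the norm on the cone. *)
Lemma effect_contraction X f : effect X -> nr (X f) <= nr f.
Proof.
move=> eX; have [sX pX lX] := eX.
rewrite -(ler_pXn2r (ltn0Sn 1)) ?nnegrE ?nr_ge0 // -!nr_inner.
apply: le_trans (cstar_pos_le_nr _ (lX f)); last exact: pX.
by apply: cstar_pos_le_nr (effect_sqr f eX); apply: inner_pos.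
Qed.

Lemma effect_scale T M : 0 < M -> sym_op T -> pos_op T ->
  (forall f, nr (T f) <= M * nr f) -> effect (fun f => M^-1%:C *: T f).
Proof.
move=> M0 sT pT bT; have M1 : 0 <= M^-1 by rewrite invr_ge0 ltW.
split; first exact: sym_op_scale.
- by move=> f; rewrite innerZl; apply: cstar_posZ.
- move=> f; apply: (@contraction_pos (fun f => M^-1%:C *: T f)).
    exact: sym_op_scale.
  by move=> g; rewrite nrZ_real // mulrC ler_pdivrMr // mulrC.
Qed.

(** The contraction [X = 1 - T / N] commutes with [P], so [P X <= P], which says that [P T / N] is
    positive. *)
Lemma pos_op_mul P T M : sym_op P -> pos_op P -> sym_op T -> pos_op T ->
  (forall f, nr (T f) <= M * nr f) -> (forall f, P (T f) = T (P f)) ->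
  pos_op (fun f => P (T f)).
Proof.
move=> sP pP sT pT bT PT f.
pose N := Num.max M 1; have N0 : 0 < N by rewrite lt_max ltr01 orbT.
have bN g : nr (T g) <= N * nr g.
  by rewrite (le_trans (bT g)) // ler_wpM2r ?nr_ge0 // le_max lexx.
have eX := effect_compl (effect_scale N0 sT pT bN).
have [sX _ _] := eX.
apply: (@cstar_posZ_inv _ _ N^-1); first by rewrite invr_gt0.
have := pos_op_contraction sP pP sX (fun g => effect_contraction g eX) _ f.
rewrite (sym_opB _ _ sP) (sym_opZ _ _ sP) innerBl innerZl opprB addrC addrNK.
by apply=> g; rewrite (sym_opB _ _ sP) (sym_opZ _ _ sP) PT.
Qed.

(** This is [T^2 <= M T] in norm form: [X^2 <= X] for [X = T / M]. *)
Lemma pos_op_sqr_bound T M f : 0 < M -> sym_op T -> pos_op T ->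
  (forall f, nr (T f) <= M * nr f) -> nr (T f) ^+ 2 <= M * nr << T f, f >>.
Proof.
move=> M0 sT pT bT; have eX := effect_scale M0 sT pT bT.
have M1 : 0 <= M^-1 by rewrite invr_ge0 ltW.
have := cstar_pos_le_nr (inner_pos _) (effect_sqr f eX).
rewrite nr_inner innerZl !nrZ_real // exprMn => h.
have := ler_wpM2l (ltW (exprn_gt0 2 M0)) h.
have -> : M ^+ 2 * (M^-1 ^+ 2 * nr (T f) ^+ 2) = nr (T f) ^+ 2.
  by field; rewrite gt_eqF.
by have -> : M ^+ 2 * (M^-1 * nr << T f, f >>) = M * nr << T f, f >>
  by field; rewrite gt_eqF.
Qed.

Lemma iter_comm T P n f : (forall f, P (T f) = T (P f)) -> iter n T (P f) = P (iter n T f).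
Proof. by move=> PT; elim: n => //= n ->. Qed.

Lemma iter_contraction X n f : (forall f, nr (X f) <= nr f) -> nr (iter n X f) <= nr f.
Proof. by move=> cX; elim: n => //= n; apply: le_trans. Qed.

(* With [X = 1 - Y], the operators [Y X^(2k)] decrease in [k] and are at most
   [X^(2k) - X^(2k+2)], so that [n Y X^(2n) <= 1] by telescoping. *)
Lemma effect_power_bound Y n f : effect Y -> let X f := f - Y f in
  cstar_pos (<< f, f >> - n%:R%:C *: << Y (iter n X f), iter n X f >>).
Proof.
move=> eY X; have eX : effect X := effect_compl eY.
have [sY pY _] := eY; have [sX _ _] := eX.
have YX g : Y (X g) = X (Y g) by rewrite /X (sym_opB _ _ sY).
have cX g : nr (X g) <= nr g := effect_contraction g eX.
(* The induction needs the sharper [n Y X^(2n) <= 1 - X^(2n)]. *)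
suff : cstar_pos (<< f, f >> - << iter n X f, iter n X f >>
    - n%:R%:C *: << Y (iter n X f), iter n X f >>).
  move=> /(cstar_posD (inner_pos (iter n X f))); congr cstar_pos.
  by rewrite addrA [_ + (_ - _)]addrC addrNK.
elim: n => [|n ih].
  by rewrite /= scale0r subr0 subrr; apply: cstar_pos0.
set g := iter n X f in ih *; rewrite iterS -/g.
(* From [X^2 <= X] comes [Y = 1 - X <= 1 - X^2]. *)
have h1 : cstar_pos (<< g, g >> - << X g, X g >> - << Y g, g >>).
  have := effect_sqr g eX; congr cstar_pos.
  have -> : << Y g, g >> = << g, g >> - << X g, g >>.
    by rewrite -innerBl /X opprB addrC addrNK.
  by rewrite opprB [RHS]addrC addrA addrNK.
have h2 : cstar_pos (<< Y g, g >> - << Y (X g), X g >>).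
  rewrite -sX -YX.
  apply: (@pos_op_contraction Y (fun f => X (X f))) => //.
  - exact: sym_op_comp.
  - by move=> u; apply: le_trans (cX _) (cX _).
  - by move=> u; rewrite !YX.
have := cstar_posD (cstar_posD ih h1) (cstar_posZ (ler0n R n.+1) h2).
congr cstar_pos.
rewrite scalerBr addrA; congr (_ - _).
have -> : n.+1%:R%:C *: << Y g, g >> = n%:R%:C *: << Y g, g >> + << Y g, g >>.
  by rewrite -natr1 rmorphD scalerDl; congr (_ + _); exact: scale1r.
by rewrite addrACA !addrNK addrA addrNK.
Qed.

Lemma bounded_below T M a : 0 < M -> 0 < a -> sym_op T -> pos_op T ->
  (forall f, nr (T f) <= M * nr f) ->
  (forall f, a * nr f ^+ 2 <= nr << T f, f >>) ->
  exists2 c : R, 0 < c & forall f, cstar_pos (<< T f, f >> - c%:C *: << f, f >>).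
Proof.
move=> M0 a0 sT pT bT hT.
have M1 : 0 < M^-1 by rewrite invr_gt0.
pose Y f := M^-1%:C *: T f; have eY : effect Y := effect_scale M0 sT pT bT.
pose X f := f - Y f; have eX : effect X := effect_compl eY.
have [sY pY _] := eY; have [sX _ _] := eX.
have YX g : Y (X g) = X (Y g) by rewrite /X (sym_opB _ _ sY).
have cX g : nr (X g) <= nr g := effect_contraction g eX.
(* With this [n], [4 |X^n f|^2 <= (a n / M) |X^n f|^2 <= |f|^2], the last by [effect_power_bound];
   so [2 X^n] is a contraction. *)
have [n an] : exists n, 4 * M <= a * n%:R.
  exists (Num.bound (4 * M / a)).
  rewrite [leRHS]mulrC -ler_pdivrMr //; apply/ltW/archi_boundP.
  by rewrite divr_ge0 ?mulr_ge0 // ltW.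
have n0 : 0 < n%:R :> R by rewrite -(pmulr_rgt0 _ a0) (lt_le_trans _ an) // mulr_gt0.
pose Z f := (2 : R)%:C *: iter n X f.
have sZ : sym_op Z by apply/sym_op_scale/sym_op_iter.
have cZ f : nr (Z f) <= nr f.
  rewrite nrZ_real // -(ler_pXn2r (ltn0Sn 1)) ?nnegrE ?mulr_ge0 ?nr_ge0 //.
  set g := iter n X f.
  have := cstar_pos_le_nr (cstar_posZ (ltW n0) (pY g)) (effect_power_bound n f eY).
  rewrite nr_inner innerZl (nrZ_real _ (ltW n0)) (nrZ_real _ (ltW M1)); apply: le_trans.
  have s0 : 0 <= n%:R * M^-1 by rewrite mulr_ge0 // ltW.
  rewrite mulrA; apply: le_trans (ler_wpM2l s0 (hT g)).
  rewrite mulrA exprMn ler_wpM2r ?sqr_ge0 //.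
  by rewrite mulrAC ler_pdivlMr // [leRHS]mulrC; lra.
(* The constant is read off from [1 <= 2 (1 - X^n) <= 2 n T / M]. *)
exists (M / (2 * n%:R)); first by rewrite divr_gt0 // mulr_gt0.
move=> f.
(* [1 - X^k] is the sum of the [Y X^i] with [i < k], each at most [Y]. *)
have tele k : cstar_pos (k%:R%:C *: << Y f, f >> - << f - iter k X f, f >>).
  elim: k => [|k ih]; first by rewrite /= scale0r subrr inner0l subr0; apply: cstar_pos0.
  have := @pos_op_contraction Y (iter k X) sY pY (sym_op_iter k sX)
    (fun g => iter_contraction k g cX) (fun g => esym (iter_comm k g YX)) f.
  move/(cstar_posD ih); congr cstar_pos.
  have -> : << f - iter k.+1 X f, f >>
      = << f - iter k X f, f >> + << Y (iter k X f), f >>.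
    by rewrite -innerDl iterS [X (iter _ _ _)]/X opprB addrA addrAC.
  have -> : k.+1%:R%:C *: << Y f, f >> = k%:R%:C *: << Y f, f >> + << Y f, f >>.
    by rewrite -natr1 rmorphD scalerDl; congr (_ + _); exact: scale1r.
  by rewrite opprD addrACA.
have := cstar_posD (cstar_posD (tele n) (tele n)) (contraction_pos f sZ cZ).
have -> : n%:R%:C *: << Y f, f >> - << f - iter n X f, f >>
  + (n%:R%:C *: << Y f, f >> - << f - iter n X f, f >>) + (<< f, f >> - << Z f, f >>)
  = (2 : R)%:C *: (n%:R%:C *: << Y f, f >>) - << f, f >>.
  rewrite -scale2r scalerBr -addrA; congr (_ + _).
  rewrite innerBl scalerBr innerZl [(2 : R)%:C *: << f, f >>]scale2r opprB.
  by rewrite addrC addrA addrNK opprD addrA subrr add0r.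
have c0 : 0 <= M / (2 * n%:R) by rewrite divr_ge0 ?mulr_ge0 ?ltW.
move/(cstar_posZ c0); congr cstar_pos; rewrite scalerBr; congr (_ - _).
rewrite innerZl !scalerA -!(rmorphM (real_complex R)) /=.
have -> : M / (2 * n%:R) * 2 * n%:R * M^-1 = 1 by field; rewrite !gt_eqF.
exact: scale1r.
Qed.
End SymmetricOperators.

(** * Unconditional series of positive symmetric operators *)

Lemma partial_sum_subset (I : choiceType) (V : zmodType) (x : I -> V) (F G : {fset I}) :
  (F `<=` G)%fset -> partial_sum x G = partial_sum x F + partial_sum x (G `\` F)%fset.
Proof.
move=> /fsubsetP FG; rewrite /partial_sum -!(big_seq_fsetE _ _ xpredT).
rewrite (big_fsetID _ (mem F)) /=; congr (_ + _); apply: eq_fbigl => i.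
  by rewrite !inE /= andbC; case: (boolP (i \in F)) => // /FG ->.
by rewrite !inE /= andbC.
Qed.

#[local] Existing Instance totally_filter.

Section SymSeries.
Context {R : realType} {A : cstarAlgType R} {H : hilbertModType A} {J : choiceType}.
Implicit Types (f g h : H) (F G : {fset J}) (M : R).
Local Notation "<< f , g >>" := (inner f g).

Variables (K : J -> H -> H) (q : H -> A) (b : R).
Hypothesis sK : forall j, sym_op (K j).
Hypothesis pK : forall j, pos_op (K j).
Hypothesis b0 : 0 < b.
Hypothesis Kq : forall f, partial_sum (fun j => << K j f, f >>) @ totally --> q f.
Hypothesis qb : forall f, nr (q f) <= b * nr f ^+ 2.

Let S F f : H := partial_sum (fun j => K j f) F.

Lemma inner_partial_op F f g : << S F f, g >> = partial_sum (fun j => << K j f, g >>) F.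
Proof. exact: inner_suml. Qed.

Lemma partial_op_sym F : sym_op (S F).
Proof.
move=> f g; rewrite inner_partial_op inner_star inner_partial_op /partial_sum.
rewrite (big_morph _ (@starD R A) (@star0 R A)); apply: eq_bigr => j _.
by rewrite -inner_star sK.
Qed.

Lemma partial_op_pos F : pos_op (S F).
Proof. by move=> f; rewrite inner_partial_op; apply: cstar_pos_sum => j; apply: pK. Qed.

Lemma partial_op_subset F G f : (F `<=` G)%fset -> S G f = S F f + S (G `\` F)%fset f.
Proof. exact: partial_sum_subset. Qed.

Lemma partial_op_limit f (e : R) : 0 < e ->
  exists F, forall G, (F `<=` G)%fset -> nr (q f - << S G f, f >>) < e.
Proof.
move=> e0; have [F _ hF] := cvg_nr (@Kq f) e0.
by exists F => G FG; rewrite inner_partial_op; apply: hF.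
Qed.

(** Enlarging [F] adds a positive form, and the closed cone carries this to the limit. *)
Lemma partial_op_le F f : cstar_pos (q f - << S F f, f >>).
Proof.
apply: cstar_pos_closed => e e0; have [G hG] := partial_op_limit f e0.
exists (<< S ((F `|` G) `\` F)%fset f, f >>); first exact: partial_op_pos.
have -> : << S ((F `|` G) `\` F)%fset f, f >> = << S (F `|` G)%fset f, f >> - << S F f, f >>.
  by rewrite (partial_op_subset f (fsubsetUl F G)) innerDl addrAC subrr add0r.
rewrite opprB addrA addrNK ltW //; apply: hG; exact: fsubsetUr.
Qed.

(** The forms are dominated by [q], uniformly in [F]; polarization costs the factor 4. *)
Lemma partial_op_bound F f : nr (S F f) <= 4 * b * nr f.
Proof.
apply: sym_op_bound; first exact: partial_op_sym.
move=> g; apply: le_trans (qb g); apply: cstar_pos_le_nr (partial_op_le F g).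
exact: partial_op_pos.
Qed.

Lemma series_pos f : cstar_pos (q f).
Proof.
by have := partial_op_le fset0 f; rewrite inner_partial_op /partial_sum big_fset0 subr0.
Qed.

Lemma series_le f : cstar_pos ((4 * b)%:C *: << f, f >> - q f).
Proof.
have B0 : 0 < 4 * b by rewrite mulr_gt0.
apply: cstar_pos_closed => e e0; have [F hF] := partial_op_limit f e0.
exists ((4 * b)%:C *: << f, f >> - << S F f, f >>); last first.
  by rewrite opprB addrC addrA addrNK -opprB nrN ltW // hF // fsubset_refl.
have [_ _ /(_ f) h] :=
  effect_scale B0 (@partial_op_sym F) (@partial_op_pos F) (partial_op_bound F).
have := cstar_posZ (ltW B0) h; congr cstar_pos.
by rewrite scalerBr innerZl scale_invK // gt_eqF.
Qed.

(** For [T] the increment from [F] to [G], [T^2 <= 4 b T] bounds [|T f|^2] by the norm of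
    [<< T f, f >>], a difference of two values near [q f]. *)
Lemma series_op f : exists u : H, (fun F => S F f) @ totally --> u.
Proof.
apply: nr_complete => e e0.
have B0 : 0 < 4 * b by rewrite mulr_gt0.
(* The last halving pays for the two distances to [q f]. *)
have e1 : 0 < e ^+ 2 / (4 * b) / 2 by rewrite !divr_gt0 // exprn_gt0.
have [F hF] := partial_op_limit f e1; exists (S F f); exists F => // G /= FG.
rewrite (partial_op_subset f FG) opprD addrA subrr add0r nrN.
rewrite -(ltr_pXn2r (ltn0Sn 1)) ?nnegrE ?nr_ge0 ?ltW //.
have h := pos_op_sqr_bound f B0 (@partial_op_sym (G `\` F)%fset)
  (@partial_op_pos _) (partial_op_bound _).
apply: (le_lt_trans h); rewrite mulrC -ltr_pdivlMr //.
have -> : << S (G `\` F)%fset f, f >> = (q f - << S F f, f >>) - (q f - << S G f, f >>).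
  by rewrite opprB addrC addrA addrNK (partial_op_subset f FG) innerDl addrAC subrr add0r.
apply: le_lt_trans (nrB _ _) _.
have := hF F (fsubset_refl _); have := hF G FG; lra.
Qed.

Lemma inner_cvgl (T : Type) (N : set_system T) {FN : Filter N} (u : T -> H) (l g : H) :
  u @ N --> l -> (fun t => << u t, g >>) @ N --> << l, g >>.
Proof.
move=> ul; apply/nr_cvg => e e0.
have g0 : 0 < 4 * (nr g + 1) by rewrite mulr_gt0 // ltr_wpDl ?nr_ge0.
have := @cvg_nr _ _ _ _ FN _ _ _ ul (divr_gt0 e0 g0); apply: filterS => t.
rewrite ltr_pdivlMr // -innerBl => h; apply: le_lt_trans (nr_inner_le _ _) _.
apply: le_lt_trans h; have := nr_ge0 (l - u t); lra.
Qed.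

Lemma inner_cvgr (T : Type) (N : set_system T) {FN : Filter N} (u : T -> H) (l g : H) :
  u @ N --> l -> (fun t => << g, u t >>) @ N --> << g, l >>.
Proof.
move=> /(inner_cvgl (g := g)) ul; apply/nr_cvg => e e0.
have := @cvg_nr _ _ _ _ FN _ _ _ ul e0; apply: filterS => t.
by rewrite -nr_star starB -!inner_star.
Qed.

(** The strong limit [T] of the partial sums represents [q] and inherits symmetry, positivity and
    the norm bound, so [bounded_below] applies. *)
Lemma series_ge (a : R) : 0 < a -> (forall f, a * nr f ^+ 2 <= nr (q f)) ->
  exists2 c : R, 0 < c & forall f, cstar_pos (q f - c%:C *: << f, f >>).
Proof.
move=> a0 aq; have B0 : 0 < 4 * b by rewrite mulr_gt0.
have [T hT] := choice series_op.
have Tf f : << T f, f >> = q f.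
  apply: (norm_cvg_unique (inner_cvgl (g := f) (hT f))).
  rewrite (_ : (fun F => _) = partial_sum (fun j => << K j f, f >>)); first exact: Kq.
  by apply/funext => F; exact: inner_partial_op.
have sT : sym_op T.
  move=> f g; apply: (norm_cvg_unique (inner_cvgl (g := g) (hT f))).
  rewrite (_ : (fun F => _) = (fun F => << f, S F g >>)); first exact: inner_cvgr.
  by apply/funext => F; exact: partial_op_sym.
have bT f : nr (T f) <= 4 * b * nr f.
  apply/ler_addgt0Pr => e e0; have [F _ hF] := cvg_nr (hT f) e0.
  have {hF} := hF F (fsubset_refl _) => hF.
  rewrite -(subrK (S F f) (T f)) (le_trans (nrD _ _)) //.
  have := partial_op_bound F f; lra.
have pT : pos_op T by move=> f; rewrite Tf; apply: series_pos.
have [c c0 hc] := bounded_below B0 a0 sT pT bT ltac:(by move=> f; rewrite Tf).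
by exists c => // f; rewrite -Tf.
Qed.
End SymSeries.

(** * Adjointable operators and the equivalence of the order and norm bounds *)

Section Adjointable.
Context {R : realType} {A : cstarAlgType R} {H : hilbertModType A}.
Implicit Types (f g h : H).
Local Notation "<< f , g >>" := (inner f g).

Lemma adjointable_sym (V : set H) (L : adjointable V) :
  sym_op (fun f => adj_star L (L f)).
Proof. by move=> f g; rewrite inner_star -!adj_opP -inner_star. Qed.

Lemma adjointable_pos (V : set H) (L : adjointable V) :
  pos_op (fun f => adj_star L (L f)).
Proof.
move=> f; rewrite (@adjointable_sym _ L) -adj_opP; exact: inner_pos.
Qed.

Lemma bounded_opP (T : H -> H) : bounded_op T ->
  exists2 M : R, 0 < M & forall f, nr (T f) <= M * nr f.
Proof.
move=> [M hM]; exists (Num.max M 1); first by rewrite lt_max ltr01 orbT.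
move=> f; have := hM f; rewrite !nrE -rmorphM lecR => /le_trans; apply.
by rewrite ler_wpM2r ?nr_ge0 // le_max lexx.
Qed.

End Adjointable.

Theorem theorem3p1 (R : realType) (A : cstarAlgType R) (H : hilbertModType A)
    (J : choiceType) (V : J -> set H) (C C' : {linear H -> H})
    (L : forall j, adjointable (V j)) :
  (forall j, closed_submodule (V j)) ->
  GLplus C -> GLplus C' ->
  (forall f, C (C' f) = C' (C f)) ->
  (forall j f, C (adj_star (L j) (L j f)) = adj_star (L j) (L j (C f))) ->
  (forall j f, C' (adj_star (L j) (L j f)) = adj_star (L j) (L j (C' f))) ->
  (forall f, ctrl_cvg C C' L f) ->
  controlled_gframe C C' L <->
  exists a b : R, [/\ 0 < a, 0 < b &
    forall f : H, a%:C * `|f| ^+ 2 <= `|ctrl_sum C C' L f|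
                  /\ `|ctrl_sum C C' L f| <= b%:C * `|f| ^+ 2].
Proof.
move=> _ [bC pC _] [bC' pC' _] CC' CP C'P cv.
have normE (a b : R) : (forall f : H, a%:C * `|f| ^+ 2 <= `|ctrl_sum C C' L f|
    /\ `|ctrl_sum C C' L f| <= b%:C * `|f| ^+ 2) <->
    (forall f : H, a * nr f ^+ 2 <= nr (ctrl_sum C C' L f)
    /\ nr (ctrl_sum C C' L f) <= b * nr f ^+ 2).
  by split=> h f; have := h f; rewrite !nrE -!rmorphXn -!rmorphM !lecR.
split=> [[a [b [/andP[a0 ab] h]]]|[a [b [a0 b0 /normE h]]]].
  have b0 := lt_le_trans a0 ab.
  exists a, b; split=> //; apply/normE => f; have [_ h1 h2] := h f.
  (* The sum dominates a positive element, hence is positive; norm monotonicity then gives both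
     estimates. *)
  have pa := cstar_posZ (ltW a0) (inner_pos f).
  have pq : cstar_pos (ctrl_sum C C' L f).
    by rewrite -(subrK (a%:C *: inner f f) (ctrl_sum _ _ _ _)); apply: cstar_posD.
  split.
    by rewrite -nr_inner -(nrZ_real _ (ltW a0)); apply: cstar_pos_le_nr h1.
  by rewrite -nr_inner -(nrZ_real _ (ltW b0)); apply: cstar_pos_le_nr h2.
have sC := pos_op_sym pC; have sC' := pos_op_sym pC'.
have [M M0 CM] := bounded_opP bC; have [M' M'0 CM'] := bounded_opP bC'.
pose D f := C (C' f).
have sD : sym_op D by apply: sym_op_comp.
have pD : pos_op D by apply: (@pos_op_mul _ _ _ C C' M').
have bD f : nr (D f) <= M * M' * nr f.
  by rewrite (le_trans (CM _)) // -mulrA ler_wpM2l // ltW.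
pose P j f := adj_star (L j) (L j f).
have PD j f : P j (D f) = D (P j f) by rewrite /P /D C'P CP.
pose K j f := P j (D f).
have sK j : sym_op (K j) by apply: sym_op_comp (sD) _ => //; apply: adjointable_sym.
have pK j : pos_op (K j).
  apply: (@pos_op_mul _ _ _ (P j) D (M * M')) => //.
    exact: adjointable_sym.
  exact: adjointable_pos.
(* Moving [L j] and then [C] across the inner product gives [<< f, C (P j (C' f)) >>]; then [C]
   commutes past [P j]. *)
have tE f j : ctrl_term C C' L f j = inner (K j f) f.
  rewrite /ctrl_term adj_opP sC CP -/(D f) -[adj_star _ _]/(K j f).
  by rewrite (sK j).
have Kq f : partial_sum (fun j => inner (K j f) f) @ totally --> ctrl_sum C C' L f.
  rewrite (_ : (fun j => _) = ctrl_term C C' L f); last by apply/funext => j; rewrite tE.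
  exact: cv.
have [c c0 hc] := series_ge sK pK b0 Kq (fun f => (h f).2) a0 (fun f => (h f).1).
have hb := series_le sK pK b0 Kq (fun f => (h f).2).
(* The maximum secures the ordering of the two constants required by [controlled_gframe]. *)
exists c, (Num.max (4 * b) c); split; first by rewrite c0 le_max lexx orbT.
move=> f; split=> //; first exact: hc.
have m0 : 0 <= Num.max (4 * b) c - 4 * b by rewrite subr_ge0 le_max lexx.
have := cstar_posD (hb f) (cstar_posZ m0 (inner_pos f)); rewrite /cstar_le; congr cstar_pos.
by rewrite rmorphB scalerBl addrC addrA addrNK.
Qed.
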